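(* Suppose all transmitters share a common shaping lattice, $\Lambda_{s,1}=\cdots=\Lambda_{s,L}$. Then $\mathcal{R}_{\mathrm{cpr}}=\mathcal{R}_{\mathrm{SW}}$, where $\mathcal{R}_{\mathrm{cpr}}=\{R\in\mathbb{R}^L:\sum_{m\in\mathcal{S}}R_m\ge f(\mathcal{S})\ \forall\mathcal{S}\subseteq\mathcal{I}_L\}$ with $f(\mathcal{S})=\sum_{k=1}^{2L-1}\big(\operatorname{rank}A(\mathcal{I}_L,\mathcal{L}_k)-\operatorname{rank}A(\overline{\mathcal{S}},\mathcal{L}_k)\big)r_{v,k}$, and $\mathcal{R}_{\mathrm{SW}}=\{R\in\mathbb{R}^L:\sum_{m\in\mathcal{S}}R_m\ge H(\{v_m\}_{m\in\mathcal{S}}\mid\{v_m\}_{m\in\overline{\mathcal{S}}})\ \forall\mathcal{S}\subseteq\mathcal{I}_L\}$ is the Slepian–Wolf region.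
   Context: Notation: for a lattice $\Lambda\subset\mathbb{R}^n$, $Q_\Lambda(x)$ is the nearest point of $\Lambda$ to $x$ (ties broken by a fixed rule), $x\bmod\Lambda=x-Q_\Lambda(x)$, $\mathcal{V}(\Lambda)=\{x:Q_\Lambda(x)=0\}$. $\mathcal{I}_j=\{1,\dots,j\}$, $\mathcal{I}_0=\emptyset$, $\overline{\mathcal{S}}=\mathcal{I}_L\setminus\mathcal{S}$. Logarithms base 2. $H(\cdot)$, $H(\cdot\mid\cdot)$ are $\frac1n$ times Shannon (conditional) entropy in bits; conditioning on an empty collection is unconditional. Lattice chain (Construction A): $\gamma$ prime, $L,n,K$ positive integers, $G\in\mathbb{F}_\gamma^{n\times K}$ of full column rank over $\mathbb{F}_\gamma$, $B\in\mathbb{R}^{n\times n}$ invertible, $g:\mathbb{F}_\gamma\to\{0,\dots,\gamma-1\}$ natural bijection entrywise; for $0\le i_1\le\cdots\le i_{2L}\le K$, $\Lambda_k=B(\gamma^{-1}g(\{G_kw:w\in\mathbb{F}_\gamma^{i_k}\})+\mathbb{Z}^n)$, $G_k$ = first $i_k$ columns of $G$; $\Lambda_1\subseteq\cdots\subseteq\Lambda_{2L}$; $\mathcal{V}_k=\mathcal{V}(\Lambda_k)$; $r_{v,k}=\frac1n\log|\Lambda_{k+1}\cap\mathcal{V}_k|$. Sources: $\pi$ permutation of $\mathcal{I}_{2L}$ with $\Lambda_{\pi(2l-1)}\subseteq\Lambda_{\pi(2l)}$; $\Lambda_{s,l}=\Lambda_{\pi(2l-1)}$, $\Lambda_{c,l}=\Lambda_{\pi(2l)}$,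 $\mathcal{C}_l=\Lambda_{c,l}\cap\mathcal{V}(\Lambda_{s,l})$. $t_1,\dots,t_L$ independent, $t_l$ uniform on $\mathcal{C}_l$; $\beta_l>0$; dithers $d_l$ uniform on $\mathcal{V}(\Lambda_{s,l})/\beta_l$, independent of each other and of the $t_l$. $\mathcal{L}_k=\{l:\Lambda_{s,l}\subseteq\Lambda_k\subseteq\Lambda_{k+1}\subseteq\Lambda_{c,l}\}$. Computed codewords: $A=(a_{ml})\in\mathbb{Z}^{L\times L}$ invertible mod $\gamma$; $A(\mathcal{S},\mathcal{S}')$ submatrix with rows $\mathcal{S}$, columns $\mathcal{S}'$; ranks over $\mathbb{F}_\gamma$ after reduction mod $\gamma$, empty matrices have rank $0$. $v_m=\big(\sum_l a_{ml}(t_l-Q_{\Lambda_{s,l}}(t_l-\beta_ld_l))\big)\bmod\Lambda_1$.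
   Formalization: The fixed tie-breaking rule for the nearest-point map is taken to be invariant under lattice translations, Q_Λ(x+λ)=Q_Λ(x)+λ for λ in Λ, so that V(Λ) is a fundamental region; for arbitrary rules (e.g. ties rounded toward zero) the equality can fail. *)

(* Defs.v *)
From mathcomp Require Import all_boot all_algebra finmap.
From mathcomp Require Import all_classical all_reals all_analysis.
Set Implicit Arguments. Unset Strict Implicit. Unset Printing Implicit Defensive.
Import GRing.Theory Num.Theory.
Local Open Scope ring_scope.
Local Open Scope classical_set_scope.

(* Conventions:
   - vectors of R^n are column vectors 'cV[R]_n;
   - lattice indices are 0-based: the paper's Lambda_k (k=1..2L) is [Lat (k-1)];
   - sources / rows of A are 0-based: the paper's index l=1..L is the ordinal
     l-1 : 'I_L; a subset S of I_L is a {set 'I_L};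
   - a family (x_1,...,x_L) of vectors of R^n is an n x L matrix whose l-th
     column is x_l. *)

Section Setup.
Variable R : realType.

Definition log2 (x : R) : R := ln x / ln 2.

Definition card_set (T : choiceType) (E : set T) : nat := size (fset_set E).

Definition normsq (n : nat) (x : 'cV[R]_n) : R := \sum_i (x i 0) ^+ 2.

(* Lebesgue measure on R^m, computed as the iterated integral (Tonelli) of the
   indicator w.r.t. the Lebesgue measure on R, one coordinate at a time. *)
Fixpoint iter_int (m : nat) (f : seq R -> \bar R) : \bar R :=
  match m with
  | 0 => f [::]
  | m'.+1 => (\int[@lebesgue_measure R]_x iter_int m' (fun s => f (x :: s)))%E
  end.

Definition mat_of_seq (p q : nat) (s : seq R) : 'M[R]_(p, q) :=
  \matrix_(i < p, j < q) nth 0 s (j * p + i).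

Definition leb_mx (p q : nat) (E : set 'M[R]_(p, q)) : \bar R :=
  iter_int (p * q) (fun s => (if `[< E (mat_of_seq p q s) >] then 1 else 0)%:E).

Variables (gamma n K L : nat).
Variable G : 'M['F_gamma]_(n, K).
Variable B : 'M[R]_n.
Variable i : nat -> nat.          (* i k = the paper's i_{k+1}, k = 0..2L-1 *)
Variable pi : nat -> nat.         (* pi k = the paper's pi(k+1) - 1 *)
Variable beta : 'I_L -> R.
Variable A : 'M[int]_L.
Variable Q : set 'cV[R]_n -> 'cV[R]_n -> 'cV[R]_n.

Definition gmap (m p : nat) (M : 'M['F_gamma]_(m, p)) : 'M[R]_(m, p) :=
  map_mx (fun a : 'F_gamma => (nat_of_ord a)%:R) M.

(* Construction A lattice Lambda_{k+1} = B (gamma^-1 g({G_{k+1} w}) + Z^n);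
   G_{k+1} w (w in F^{i_{k+1}}) is written G w' with w' in F^K vanishing
   outside the first i_{k+1} coordinates. *)
Definition Lat (k : nat) : set 'cV[R]_n :=
  [set x | exists w : 'cV['F_gamma]_K,
      (forall j : 'I_K, (i k <= j)%N -> w j 0 = 0) /\
      exists z : 'cV[int]_n,
        x = B *m ((gamma%:R)^-1 *: gmap (G *m w) + map_mx intr z)].

Definition Vor (Lam : set 'cV[R]_n) : set 'cV[R]_n := [set x | Q Lam x = 0].
Definition modL (Lam : set 'cV[R]_n) (x : 'cV[R]_n) := x - Q Lam x.

(* Q is a nearest-point map of Lam with a fixed (lattice-invariant) tie rule *)
Definition nearest_point_map (Lam : set 'cV[R]_n) : Prop :=
  forall x, Lam (Q Lam x) /\
            (forall y, Lam y -> normsq (x - Q Lam x) <= normsq (x - y)) /\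
            (forall y, Lam y -> Q Lam (x + y) = Q Lam x + y).

(* r_{v,k} (paper's k = k0+1) *)
Definition rv (k0 : nat) : R :=
  n%:R^-1 * log2 ((card_set (Lat k0.+1 `&` Vor (Lat k0)))%:R).

Definition sidx (l : 'I_L) : nat := pi (2 * l).
Definition cidx (l : 'I_L) : nat := pi (2 * l).+1.
Definition LamS (l : 'I_L) := Lat (sidx l).
Definition LamC (l : 'I_L) := Lat (cidx l).
Definition Cb (l : 'I_L) : set 'cV[R]_n := LamC l `&` Vor (LamS l).

(* paper's L_k, with k = k0+1 *)
Definition Lk (k0 : nat) : {set 'I_L} :=
  [set l | `[< LamS l `<=` Lat k0 /\ Lat k0 `<=` Lat k0.+1 /\
              Lat k0.+1 `<=` LamC l >]].

Definition Agam : 'M['F_gamma]_L := map_mx (fun a : int => a%:~R) A.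
Definition subrank (S S' : {set 'I_L}) : nat :=
  \rank (mxsub (fun r : 'I_#|S| => enum_val r) (fun c : 'I_#|S'| => enum_val c)
           Agam).

Definition fcpr (S : {set 'I_L}) : R :=
  \sum_(k0 < (2 * L).-1)
     ((subrank (finset.setT : {set 'I_L}) (Lk k0))%:R - (subrank (~: S) (Lk k0))%:R) * rv k0.

(* computed codewords v_m (m-th column), for messages t and dithers d *)
Definition vmap (t d : 'M[R]_(n, L)) : 'M[R]_(n, L) :=
  \matrix_(r < n, m < L)
    (modL (Lat 0)
      (\sum_(l < L) (A m l)%:~R *:
         (col l t - Q (LamS l) (col l t - beta l *: col l d)))) r 0.

(* sample space: t_l uniform on C_l, d_l uniform on V(LamS l)/beta_l, all
   independent *)
Definition Tset : set 'M[R]_(n, L) := [set t | forall l, Cb l (col l t)].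
Definition Dset : set 'M[R]_(n, L) :=
  [set d | forall l, Vor (LamS l) (beta l *: col l d)].
Definition DsetV (l : 'I_L) : set 'cV[R]_n := [set y | Vor (LamS l) (beta l *: y)].

Definition Prv (E : set 'M[R]_(n, L)) : R :=
  \sum_(t <- fset_set Tset)
     (\prod_(l < L) (card_set (Cb l))%:R^-1) *
     (fine (leb_mx [set d | Dset d /\ E (vmap t d)]) /
      \prod_(l < L) fine (leb_mx (DsetV l))).

Definition pv (x : 'M[R]_(n, L)) : R := Prv [set x].

Definition projS (S : {set 'I_L}) (x : 'M[R]_(n, L)) : 'M[R]_(n, L) :=
  \matrix_(r < n, m < L) (if m \in S then x r m else 0).

Definition Hcond (S : {set 'I_L}) : R :=
  n%:R^-1 *
  - \sum_(x <- fset_set [set x | 0 < pv x])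
      pv x * log2 (pv x / Prv [set z | projS (~: S) z = projS (~: S) x]).

Definition Rcpr : set 'rV[R]_L :=
  [set Rt | forall S : {set 'I_L}, fcpr S <= \sum_(m in S) Rt 0 m].
Definition RSW : set 'rV[R]_L :=
  [set Rt | forall S : {set 'I_L}, Hcond S <= \sum_(m in S) Rt 0 m].

End Setup.

(* Main.v *)
Require Import Defs.
From mathcomp Require Import all_boot all_order all_algebra finmap mxabelem.
From mathcomp Require Import all_classical all_reals all_analysis.
Import Order.TTheory GRing.Theory Num.Theory.
Local Open Scope ring_scope.

(* The two regions coincide because H(v_S | v_S^c) = f(S) for every S.  The common
   shaping lattice must be Lambda_1, so the terms Q(t_l - beta_l d_l) vanish modulo
   Lambda_1 and v depends on t alone.  Labelling the points of Lambda_k modulo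
   Lambda_1 by vectors over F_gamma turns t into a uniform K x L matrix w, whose
   row j is supported on the set L_j of sources whose coding lattice uses column j
   of G, and turns v into w A^T.  Hence (v_m), m in S, is uniform on a linear image
   of the message space, of cardinality the product over the rows j of
   gamma ^ rank A(S, L_j); the rows with i_k <= j < i_{k+1} all have L_j equal to
   the set L_k of the statement. *)

(** * Counting matrices over a finite field, and ranks of submatrices *)

Section FiniteCounting.
Local Open Scope nat_scope.

Lemma card_forall_ffun (I U : finType) (P : I -> {pred U}) :
  #|[set f : {ffun I -> U} | [forall i, P i (f i)]]| = \prod_i #|P i|.
Proof.
rewrite [RHS](_ : _ = foldr muln 1 [seq #|P x| | x : I]); last first.
  by rewrite -(big_image _ _ _ _ id) /= foldrE.
rewrite -card_family cardsE; apply: eq_card => f.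
by apply/forallP/familyP.
Qed.

Lemma card_forall_row (U : finType) p q (P : 'I_p -> {pred 'rV[U]_q}) :
  #|[set w : 'M[U]_(p, q) | [forall j, P j (row j w)]]| = \prod_j #|P j|.
Proof.
rewrite -card_forall_ffun.
pose h (w : 'M[U]_(p, q)) := [ffun j => row j w].
rewrite -(card_imset _ (_ : injective h)); last first.
  by move=> w w' /ffunP e; apply/row_matrixP => j; have := e j; rewrite !ffunE.
apply: eq_card => f; rewrite inE; apply/imsetP/forallP => [[w]|Pf].
  by rewrite inE => /forallP Pw -> j; rewrite ffunE.
exists (\matrix_(j, l) f j ord0 l); last first.
  by apply/ffunP => j; rewrite ffunE; apply/rowP => l; rewrite !mxE.
rewrite inE; apply/forallP => j; rewrite (_ : row j _ = f j) //.
by apply/rowP => l; rewrite !mxE.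
Qed.

Lemma card_forall_col (U : finType) p q (P : 'I_q -> {pred 'cV[U]_p}) :
  #|[set w : 'M[U]_(p, q) | [forall l, P l (col l w)]]| = \prod_l #|P l|.
Proof.
rewrite (eq_bigr (fun l => #|[pred v : 'rV[U]_p | P l (v^T)%R]|)); last first.
  move=> l _; rewrite -(fintype.card_image (@trmx_inj U 1 p)); apply: eq_card => v.
  apply/idP/fintype.imageP => [Pv|[u /= Pu ->]] //.
  by exists (v^T)%R; rewrite ?trmxK// inE trmxK.
rewrite -card_forall_row -(card_imset _ (@trmx_inj U p q)).
apply: eq_card => w; rewrite inE; apply/imsetP/forallP => [[u]|Pw].
  by rewrite inE => /forallP Pu -> l; rewrite /= tr_row trmxK; exact: Pu.
exists (w^T)%R; last by rewrite trmxK.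
by rewrite inE; apply/forallP => l; have := Pw l; rewrite /= tr_row.
Qed.

End FiniteCounting.

(** Translation by [w2 - w1] stays in [D] and injects the fiber through [w1] into the fiber through
    [w2], so all fibers of [f] over [f @: D] have equal size: a uniform law on [D] is pushed to a
    uniform law on the image. *)
Lemma card_fiber (V U : finZmodType) (f : {additive V -> U}) (D : {set V}) w0 :
  (forall w w', w \in D -> w' \in D -> w - w' \in D) -> w0 \in D ->
  (#|[set w in D | f w == f w0]| * #|f @: D| = #|D|)%N.
Proof.
move=> DB Dw0.
have D0 : 0 \in D by rewrite -(subrr w0) DB.
have DN w : w \in D -> - w \in D by move=> Dw; rewrite -sub0r DB.
have le w1 w2 : w1 \in D -> w2 \in D ->
    (#|[set w in D | f w == f w1]| <= #|[set w in D | f w == f w2]|)%N.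
  move=> D1 D2; rewrite -(card_imset _ (addIr (w2 - w1))) subset_leq_card //.
  apply/fintype.subsetP => _ /imsetP[w /[!inE] /andP[Dw /eqP fw] ->].
  by rewrite -[_ - w1]opprB DB ?DB //= raddfB raddfB fw opprB subrKC eqxx.
rewrite mulnC -sum_nat_const -[RHS]sum1_card (partition_big_imset f) /=.
 apply: eq_bigr => _ /imsetP[w1 D1 ->].
by rewrite sum1dep_card; apply/eqP; rewrite eqn_leq !le.
Qed.

(** Deleting lines and zeroing them give the same rank: the 0/1 selection matrices [P] and [P'] turn
    each matrix into the other by multiplication, so each rank bounds the other. *)
Lemma rank_mask (F : fieldType) p q (M : 'M[F]_(p, q))
    (S : {set 'I_p}) (S' : {set 'I_q}) :
  \rank (mxsub (fun r : 'I_#|S| => enum_val r) (fun c : 'I_#|S'| => enum_val c) M) =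
  \rank (\matrix_(r, c) (if (r \in S) && (c \in S') then M r c else 0)).
Proof.
set N := (X in _ = \rank X); set N' := mxsub _ _ _.
pose P := \matrix_(r < #|S|, c < p) ((enum_val r == c)%:R : F).
pose P' := \matrix_(r < q, c < #|S'|) ((enum_val c == r)%:R : F).
have e1 : N' = P *m N *m P'.
  apply/matrixP => r c; rewrite !mxE (bigD1 (enum_val c)) //= big1 => [|c' /negPf nc].
    rewrite !mxE eqxx mulr1 (bigD1 (enum_val r)) //= big1 => [|r' /negPf nr].
      by rewrite !mxE !enum_valP eqxx mul1r !addr0.
    by rewrite !mxE eq_sym nr mul0r.
  by rewrite [P' _ _]mxE eq_sym nc mulr0.
have e2 : N = P^T *m N' *m P'^T.
  apply/matrixP => r c; rewrite !mxE.
  have [Sc|Sc] := boolP (c \in S'); last first.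
    rewrite andbF big1 // => c' _; rewrite !mxE.
    by case: eqP => [e|_]; [rewrite -e enum_valP in Sc|rewrite mulr0].
  rewrite (bigD1 (enum_rank_in Sc c)) //= big1 => [|c' nc]; last first.
    rewrite [P'^T _ _]mxE [P' _ _]mxE; case: eqP => [e|_]; last by rewrite mulr0.
    by case/eqP: nc; apply: enum_val_inj; rewrite enum_rankK_in.
  rewrite !mxE enum_rankK_in // eqxx mulr1 addr0 andbT.
  have [Sr|Sr] := boolP (r \in S); last first.
    rewrite big1 // => r' _; rewrite !mxE.
    by case: eqP => [e|_]; [rewrite -e enum_valP in Sr|rewrite mul0r].
  rewrite (bigD1 (enum_rank_in Sr r)) //= big1 => [|r' nr]; last first.
    rewrite [P^T _ _]mxE [P _ _]mxE; case: eqP => [e|_]; last by rewrite mul0r.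
    by case/eqP: nr; apply: enum_val_inj; rewrite enum_rankK_in.
  by rewrite !mxE !enum_rankK_in // eqxx mul1r addr0.
apply/eqP; rewrite eqn_leq {1}e1 {3}e2; apply/andP; split.
  exact: leq_trans (mxrankM_maxl _ _) (mxrankM_maxr _ _).
exact: leq_trans (mxrankM_maxl _ _) (mxrankM_maxr _ _).
Qed.

(* Row j of [w *m M] ranges, independently of the other rows, over the span of the
   rows of M indexed by X j. *)
Lemma card_imset_mulmx (F : finFieldType) p q r
    (X : 'I_p -> {set 'I_q}) (M : 'M[F]_(q, r)) :
  #|[set w *m M | w in [set w : 'M[F]_(p, q) |
        [forall j, forall l, (l \notin X j) ==> (w j l == 0)]]]| =
   (\prod_j #|F| ^ \rank (\matrix_(l, c) (if l \in X j then M l c else 0%R)))%N.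
Proof.
pose Y j := \matrix_(l, c) (if l \in X j then M l c else 0).
rewrite -(eq_bigr _ (fun j _ => card_rowg (Y j))) -card_forall_row.
apply: eq_card => u; rewrite inE; apply/imsetP/forallP => [[w]|Pu].
  rewrite inE => /forallP Dw -> j.
  suff: row j (w *m M) \in rowg (Y j) by []; rewrite mem_rowg.
  apply/submxP; exists (row j w); apply/rowP => c; rewrite !mxE.
  apply: eq_bigr => l _; rewrite !mxE; case: ifPn => // lX.
  by move: (forallP (Dw j) l); rewrite lX => /eqP ->; rewrite !mul0r.
have {}Pu j : (row j u <= Y j)%MS by rewrite -mem_rowg; exact: Pu.
(* The coefficients of row [j] of [u] over the rows of [Y j]; those outside [X j] may be reset to 0
   because they multiply zero rows. *)
exists (\matrix_(j, l) if l \in X j then (row j u *m pinvmx (Y j)) 0 l else 0).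
  rewrite inE; apply/forallP => j; apply/forallP => l; apply/implyP => /negPf lX.
  by rewrite mxE lX.
apply/matrixP => j c; rewrite !mxE.
rewrite (_ : u j c = row j u 0 c); last by rewrite mxE.
rewrite -{1}(mulmxKpV (Pu j)) mxE; apply: eq_bigr => l _; rewrite !mxE.
by case: ifP => _; rewrite ?mul0r ?mulr0.
Qed.

(** Support in [[0, i k)] will single out the words labelling points of [Lat k]; support in
    [[i a, i b)] will single out representatives of [Lat b] modulo [Lat a]. *)
Definition supp {F : nzRingType} {K : nat} (a b : nat) (w : 'cV[F]_K) : bool :=
  [forall j : 'I_K, (w j 0 != 0) ==> (a <= j < b)%N].

Lemma suppP {F : nzRingType} {K : nat} {a b : nat} {w : 'cV[F]_K} :
  reflect (forall j : 'I_K, ~~ (a <= j < b)%N -> w j 0 = 0) (supp a b w).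
Proof.
apply: (iffP forallP) => H j; last first.
  by apply/implyP; apply: contraR => /H ->.
by move=> nj; apply/eqP; apply: contraNT nj; apply/implyP.
Qed.

Lemma suppB {F : nzRingType} {K : nat} (a b : nat) (w w' : 'cV[F]_K) :
  supp a b w -> supp a b w' -> supp a b (w - w').
Proof.
by move=> /suppP sw /suppP sw'; apply/suppP => j nj; rewrite !mxE sw ?sw' ?subr0.
Qed.

(** Coordinates are chosen independently: any scalar inside the interval, only 0 outside. *)
Lemma card_supp (F : finNzRingType) K a b : (a <= b <= K)%N ->
  #|[set w : 'cV[F]_K | supp a b w]| = (#|F| ^ (b - a))%N.
Proof.
move=> /andP[ab bK].
pose P (j : 'I_K) : {pred 'rV[F]_1} :=
  [pred v : 'rV[F]_1 | (v 0 0 != 0) ==> (a <= j < b)%N].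
transitivity #|[set w : 'cV[F]_K | [forall j, P j (row j w)]]|.
  by apply: eq_card => w; rewrite !inE; apply: eq_forallb => j; rewrite /P /= !mxE.
rewrite card_forall_row -prod_nat_const_nat (big_nat_widen _ _ _ _ _ bK).
rewrite big_geq_mkord /= [RHS]big_mkcond; apply: eq_bigr => j _.
rewrite andbC; case: ifP => abj.
  rewrite (_ : #|P j| = #|{: 'rV[F]_1}|); first by rewrite card_mx muln1.
  by apply: eq_card => v; rewrite !inE abj implybT.
apply/eqP/fintype.card1P; exists 0 => v; rewrite !inE abj implybF negbK.
apply/eqP/eqP => [v0|->]; last by rewrite mxE.
by apply/rowP => c; rewrite ord1 v0 mxE.
Qed.

Lemma supp_widen {F : nzRingType} {K : nat} (a b c : nat) (w : 'cV[F]_K) :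
  (b <= c)%N -> supp a b w -> supp a c w.
Proof.
move=> bc /suppP sw; apply/suppP => j nj; apply: sw; apply: contra nj.
by move=> /andP[-> /leq_trans]; exact.
Qed.

Local Open Scope classical_set_scope.

(** * Integrals of nonnegative functions that may fail to be measurable *)

Section Integral.
Context {d : measure_display} {T : measurableType d} {R : realType}.
Variable mu : {measure set T -> \bar R}.
Local Open Scope ereal_scope.

(** The integral of a nonnegative function is a supremum over the simple functions below it, and
    this supremum is monotone for arbitrary integrands. Voronoi cells depend on an arbitrary tie
    rule, so their indicators come with no measurability. *)
Lemma ge0_le_integral_nomeas (f g : T -> \bar R) :
  (forall x, 0 <= f x) -> (forall x, f x <= g x) ->
  \int[mu]_x f x <= \int[mu]_x g x.
Proof.
move=> f0 fg; rewrite !ge0_integralTE//; last by move=> x; exact: le_trans (fg x).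
apply: ereal_sup_le => _ [h hf <-]; exists h => //= x.
exact: le_trans (hf x) (fg x).
Qed.

(** Scaling the simple functions below [f] gives one inequality; the other is the same inequality
    for [c^-1] and the function [c * f]. *)
Lemma ge0_integralZl_nomeas (f : T -> \bar R) (c : R) :
  (forall x, 0 <= f x) -> (0 < c)%R ->
  \int[mu]_x (c%:E * f x) = c%:E * \int[mu]_x f x.
Proof.
have half (g : T -> \bar R) (k : R) : (forall x, 0 <= g x) -> (0 < k)%R ->
    k%:E * \int[mu]_x g x <= \int[mu]_x (k%:E * g x).
  move=> g0 k0; rewrite -lee_pdivlMl// !ge0_integralTE//; last first.
    by move=> x; rewrite mule_ge0// lee_fin ltW.
  apply: ge_ereal_sup => _ [h hg <-]; rewrite lee_pdivlMl//.
  rewrite -sintegralrM; apply: ereal_sup_ubound => /=.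
  exists (scale_nnsfun h (ltW k0)) => //= x.
  by rewrite EFinM lee_pmul2l.
move=> f0 c0; apply/eqP; rewrite eq_le half// andbT.
have cf0 x : 0 <= c%:E * f x by rewrite mule_ge0// lee_fin ltW.
have ci : (0 < c^-1)%R by rewrite invr_gt0.
rewrite -lee_pdivrMl//; apply: le_trans (half _ _ cf0 ci) _.
apply: ge0_le_integral_nomeas => x.
  by rewrite mule_ge0 ?cf0// lee_fin ltW.
by rewrite muleA -EFinM mulVf ?gt_eqF// mul1e.
Qed.

End Integral.

(** * Iterated Lebesgue integrals of indicators *)

Section IterInt.
Context {R : realType}.
Implicit Types (f g : seq R -> \bar R) (P : seq R -> Prop).
Local Open Scope ereal_scope.

Lemma iter_int_ge0 m f : (forall s, 0 <= f s) -> 0 <= iter_int m f.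
Proof.
elim: m f => [|m IH] f f0 //=.
by apply: integral_ge0 => x _; apply: IH => s; exact: f0.
Qed.

Lemma eq_iter_int m f g :
  (forall s, size s = m -> f s = g s) -> iter_int m f = iter_int m g.
Proof.
elim: m f g => [|m IH] f g fg /=; first exact: fg.
apply: eq_integral => x _; apply: IH => s sm; apply: fg => /=; by rewrite sm.
Qed.

Lemma iter_int0 m : iter_int m (fun=> 0 : \bar R) = 0.
Proof. by elim: m => [//|m /= IH]; rewrite IH integral0_eq. Qed.

Lemma le_iter_int m f g : (forall s, 0 <= f s) ->
  (forall s, size s = m -> f s <= g s) -> iter_int m f <= iter_int m g.
Proof.
elim: m f g => [|m IH] f g f0 fg /=; first exact: fg.
apply: ge0_le_integral_nomeas => x; first by apply: iter_int_ge0 => s; exact: f0.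
by apply: IH => // s sm; apply: fg; rewrite /= sm.
Qed.

Lemma iter_intZl m f (c : R) : (forall s, 0 <= f s) -> (0 < c)%R ->
  iter_int m (fun s => c%:E * f s) = c%:E * iter_int m f.
Proof.
elim: m f => [//|m IH] f f0 c0 /=.
rewrite -ge0_integralZl_nomeas//; last by move=> x; apply: iter_int_ge0 => s.
by apply: eq_integral => x _; rewrite IH.
Qed.

Lemma iter_int_cat m p f :
  iter_int (m + p) f = iter_int m (fun s => iter_int p (fun t => f (s ++ t))).
Proof.
elim: m f => [//|m IH] f; rewrite addSn /=.
by apply: eq_integral => x _; rewrite IH.
Qed.

Definition ind_seq P (s : seq R) : \bar R := (if `[< P s >] then 1 else 0)%:E.

Lemma ind_seq_ge0 P s : 0 <= ind_seq P s.
Proof. by rewrite /ind_seq lee_fin; case: ifP. Qed.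

(** Integrating out all blocks but the first leaves the constant [c] where the first block satisfies
    its predicate and 0 elsewhere. Positivity of the [r l] makes [c] positive, so it can be pulled
    out. *)
Lemma iter_int_prod m q (P : 'I_q -> seq R -> Prop) (r : 'I_q -> R) :
  (forall l, (0 < r l)%R) ->
  (forall l, iter_int m (ind_seq (P l)) = (r l)%:E) ->
  iter_int (q * m) (ind_seq (fun s => forall l, P l (take m (drop (l * m) s)))) =
  (\prod_l r l)%R%:E.
Proof.
elim: q P r => [|q IH] P r r0 Pr.
  by rewrite mul0n big_ord0 /= /ind_seq ifT//; apply/asboolP; case.
rewrite mulSn iter_int_cat big_ord_recl.
set c := (\prod_(l < q) _)%R.
have c0 : (0 < c)%R by apply: prodr_gt0.
rewrite mulrC EFinM -(Pr ord0) -iter_intZl//; last exact: ind_seq_ge0.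
apply: eq_iter_int => s sm; rewrite [in RHS]/ind_seq; case: asboolP => Ps.
  rewrite mule1 -(IH (fun l => P (lift ord0 l)) (fun l => r (lift ord0 l)))//.
  apply: eq_iter_int => t _; rewrite /ind_seq; congr (if _ then _ else _)%:E.
  apply: asbool_equiv_eq; split=> [H l|H l].
    have := H (lift ord0 l); rewrite /= /bump leq0n add1n mulSn addnC -drop_drop.
    by rewrite -sm drop_size_cat.
  case: (unliftP ord0 l) => [l' ->|->].
    have := H l'; rewrite /= /bump leq0n add1n mulSn addnC -drop_drop.
    by rewrite -sm drop_size_cat.
  by rewrite /= mul0n drop0 take_size_cat.
rewrite mule0 -(iter_int0 (q * m)); apply: eq_iter_int => t _.
rewrite /ind_seq ifF//; apply: asboolF => /(_ ord0).
by rewrite mul0n drop0 take_size_cat.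
Qed.

Lemma iter_int_box m (a : R) : (0 < a)%R ->
  iter_int m (ind_seq (fun s => all (fun x => `|x| <= a)%R s)) = ((2 * a) ^+ m)%:E.
Proof.
move=> a0; elim: m => [|m IH] /=.
  by rewrite /ind_seq ifT ?expr0//; exact/asboolP.
have c0 : (0 < (2 * a) ^+ m)%R by rewrite exprn_gt0// mulr_gt0.
(* The inner integral is the volume of the smaller cube if the first coordinate is in range, and 0
   otherwise. *)
transitivity (\int[@lebesgue_measure R]_x
   (((2 * a) ^+ m)%:E * (\1_(`[(- a)%R, a]) x)%:E)).
  apply: eq_integral => x _; rewrite indicE.
  have [xa|xa] := boolP (`|x| <= a)%R.
    rewrite (_ : x \in _); last by rewrite inE /= in_itv/= -ler_norml.
    rewrite mule1 -IH; apply: eq_iter_int => s _; rewrite /ind_seq.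
    by congr (if _ then _ else _)%:E; apply: asbool_equiv_eq; rewrite /= xa.
  rewrite (_ : _ \in _ = false); last first.
    by apply/negP; rewrite inE /= in_itv/= -ler_norml; exact/negP.
  rewrite mule0 -(iter_int0 m); apply: eq_iter_int => s _; rewrite /ind_seq.
  by rewrite ifF//; apply: asboolF; rewrite /= (negbTE xa).
rewrite ge0_integralZl_nomeas// integral_indic// setIT.
have := lebesgue_measure_itv (Interval (BLeft (- a)%R) (BRight a)).
rewrite /= lte_fin gtrN// => ->.
by rewrite -EFinD -EFinM exprSr opprK mulr2n mulrDl mul1r.
Qed.

Lemma ind_seq_le P P' (s : seq R) : (P s -> P' s) -> ind_seq P s <= ind_seq P' s.
Proof.
rewrite /ind_seq lee_fin => PP'; case: asboolP => [Ps|_].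
  by rewrite ifT//; apply/asboolP; exact: PP'.
by case: ifP.
Qed.

(** The set is squeezed between two cubes, of volumes [(2 * a) ^+ m] and [(2 * b) ^+ m]. *)
Lemma iter_int_bounded m P (a b : R) : (0 < a)%R -> (0 < b)%R ->
  (forall s, size s = m -> all (fun x => `|x| <= a)%R s -> P s) ->
  (forall s, size s = m -> P s -> all (fun x => `|x| <= b)%R s) ->
  exists2 r, (0 < r)%R & iter_int m (ind_seq P) = r%:E.
Proof.
move=> a0 b0 aP Pb.
have lo : ((2 * a) ^+ m)%:E <= iter_int m (ind_seq P).
  rewrite -iter_int_box//; apply: le_iter_int => [s|s sm].
    exact: ind_seq_ge0.
  by apply: ind_seq_le; exact: aP.
have hi : iter_int m (ind_seq P) <= ((2 * b) ^+ m)%:E.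
  rewrite -iter_int_box//; apply: le_iter_int => [s|s sm].
    exact: ind_seq_ge0.
  by apply: ind_seq_le; exact: Pb.
have fin : iter_int m (ind_seq P) \is a fin_num.
  rewrite ge0_fin_numE; first exact: le_lt_trans hi (ltry _).
  by apply: iter_int_ge0 => s; exact: ind_seq_ge0.
exists (fine (iter_int m (ind_seq P))); last by rewrite fineK.
rewrite -lte_fin fineK//; apply: lt_le_trans lo.
by rewrite lte_fin exprn_gt0// mulr_gt0.
Qed.

End IterInt.

(** * Cardinalities of, and sums over, injective images of finite sets *)

Section FsetImage.
Context {T : finType} {U : choiceType} {f : T -> U} {P : {set T}}.
Hypothesis f_inj : {in P &, injective f}.

Lemma perm_fset_set_image :
  perm_eq (fset_set (f @` [set x | x \in P])) [seq f x | x <- enum P].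
Proof.
apply: uniq_perm; first exact: fset_uniq.
  by rewrite map_inj_in_uniq ?enum_uniq// => x y; rewrite !mem_enum; exact: f_inj.
move=> u; rewrite in_fset_set; last exact: finite_image.
apply/idP/mapP => [|[x + ->]]; rewrite ?inE.
  by case=> x Px <-; exists x; rewrite ?mem_enum.
by rewrite mem_enum => Px; exists x.
Qed.

Lemma card_set_image : card_set (f @` [set x | x \in P]) = #|P|.
Proof. by rewrite /card_set (perm_size perm_fset_set_image) size_map -cardE. Qed.

Lemma sum_fset_set_image (V : nmodType) (F : U -> V) :
  \sum_(u <- fset_set (f @` [set x | x \in P])) F u = \sum_(x in P) F (f x).
Proof. by rewrite (perm_big _ perm_fset_set_image) big_map big_enum. Qed.

End FsetImage.

(** The intervals [[i k, i k.+1)] tile [[i 0, i N)], and [h] is constant on each of them. *)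
Lemma sum_chain (V : nmodType) (h c : nat -> V) (i : nat -> nat) N :
  (forall k, (k < N)%N -> (i k <= i k.+1)%N) ->
  (forall k j, (k < N)%N -> (i k <= j < i k.+1)%N -> h j = c k) ->
  \sum_(i 0 <= j < i N) h j = \sum_(k < N) c k *+ (i k.+1 - i k).
Proof.
elim: N => [|N IH] ii hc; first by rewrite big_geq// big_ord0.
have i0N m : (m <= N)%N -> (i 0 <= i m)%N.
  elim: m => // m IHm mN; apply: leq_trans (IHm (ltnW mN)) (ii _ _).
  exact: leq_trans mN _.
rewrite big_ord_recr -IH /=.
- rewrite (big_cat_nat (i0N N (leqnn N)) (ii N (ltnSn N)))/=.
  congr (_ + _); rewrite -sumr_const_nat big_nat_cond [RHS]big_nat_cond.
  by apply: eq_bigr => j /andP[ij _]; exact: hc.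
- by move=> k kN; apply: ii; exact: leq_trans kN _.
- by move=> k j kN; apply: hc; exact: leq_trans kN _.
Qed.

(** * Quantizers, reduction modulo a lattice, and bounds on Voronoi cells *)

Section Quantizer.
Context {R : realType} {n : nat}.
Variables (Q : set 'cV[R]_n -> 'cV[R]_n -> 'cV[R]_n) (Lam : set 'cV[R]_n).
Hypothesis Qnp : nearest_point_map Q Lam.
Hypothesis LamB : forall x y, Lam x -> Lam y -> Lam (x - y).

Lemma lam0 : Lam 0.
Proof. by have [Qx _] := Qnp 0; rewrite -(subrr (Q Lam 0)); exact: LamB. Qed.

Lemma modL_add x y : Lam y -> modL Q Lam (x + y) = modL Q Lam x.
Proof.
move=> Ly; have [_ [_ QD]] := Qnp x.
by rewrite /modL QD// opprD addrACA subrr addr0.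
Qed.

Lemma Vor_modL x : Vor Q Lam (modL Q Lam x).
Proof.
have [Qx [_ QD]] := Qnp x.
by rewrite /Vor /= /modL QD ?subrr// -sub0r; apply: LamB => //; exact: lam0.
Qed.

Lemma modL_id x : Vor Q Lam x -> modL Q Lam x = x.
Proof. by rewrite /modL => ->; rewrite subr0. Qed.

(** Two points with the same remainder differ by a difference of quantizer values, which is a
    lattice point; conversely, the tie rule is invariant under lattice translations. *)
Lemma modL_eqP x y : modL Q Lam x = modL Q Lam y <-> Lam (x - y).
Proof.
split=> [exy|Lxy]; last by rewrite -[x](subrK y) addrC modL_add.
have -> : x - y = Q Lam x - Q Lam y.
  apply/eqP; rewrite -subr_eq0 -(subrr (modL Q Lam y)) -{1}exy /modL.
  by rewrite !opprB addrACA [X in _ == X]addrACA [- y - _]addrC.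
by apply: LamB; [have [] := Qnp x|have [] := Qnp y].
Qed.

Lemma normsq_ge (x : 'cV[R]_n) c : (x c 0) ^+ 2 <= normsq x.
Proof. by rewrite /normsq (bigD1 c)//= lerDl sumr_ge0// => *; exact: sqr_ge0. Qed.

Lemma normsq_le (x : 'cV[R]_n) (a : R) : 0 <= a ->
  (forall c, `|x c 0| <= a) -> normsq x <= n%:R * a ^+ 2.
Proof.
move=> a0 xa; rewrite /normsq; have -> : n%:R * a ^+ 2 = \sum_(c < n) a ^+ 2.
  by rewrite sumr_const card_ord mulr_natl.
by apply: ler_sum => c _; rewrite -real_normK ?num_real// lerXn2r ?nnegrE.
Qed.

(** If [Q Lam x] were nonzero, one of its coordinates would be at least [eta], so [x] would be
    farther from it than from 0, against minimality. *)
Lemma Vor_inner (eta : R) : 0 < eta ->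
  (forall y, Lam y -> y != 0 -> exists c, eta <= `|y c 0|) ->
  exists2 a : R, 0 < a & forall x : 'cV[R]_n, (forall c, `|x c 0| <= a) -> Vor Q Lam x.
Proof.
(* With this [a], [eta - a] is [n.+1%:R * a], whose square exceeds the bound [n%:R * a ^+ 2] on the
   squared norm of [x]. *)
move=> eta0 sep; set a : R := eta / n.+2%:R.
have a0 : 0 < a by rewrite divr_gt0.
exists a => // x xa; apply/eqP; apply: contraT => Qx0.
have [Qx [Qmin _]] := Qnp x; have [c etac] := sep _ Qx Qx0.
have := Qmin _ lam0; rewrite subr0 => le1.
have le2 : n.+1%:R * a <= `|(x - Q Lam x) c 0|.
  rewrite !mxE distrC; apply: le_trans (lerB_dist _ _).
  rewrite lerBrDr (le_trans _ etac)// (_ : eta = n.+1%:R * a + a) ?lerD2l//.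
  by rewrite -{2}[a]mul1r -mulrDl natr1 mulrC divfK// pnatr_eq0.
have := le_trans (normsq_ge _ c) (le_trans le1 (normsq_le _ _ (ltW a0) xa)).
rewrite -real_normK ?num_real// => le3.
have := le_trans _ le3; rewrite -(@ler_pXn2r _ 2) ?nnegrE// in le2; last first.
  by rewrite mulr_ge0// ltW.
move=> /(_ _ le2); rewrite exprMn ler_pM2r ?exprn_gt0// -natrX ler_nat.
by rewrite leqNgt -mulnn mulSn addSn ltnS leq_addr.
Qed.

(** A point of the cell is at least as close to 0 as to the lattice point [y] near it, so its
    squared norm is at most [n%:R * b ^+ 2]. *)
Lemma Vor_outer (b : R) : 0 <= b ->
  (forall x, exists2 y, Lam y & forall c, `|(x - y) c 0| <= b) ->
  exists2 a : R, 0 < a & forall x, Vor Q Lam x -> forall c, `|x c 0| <= a.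
Proof.
(* A crude bound on [b] times the square root of [n]; the added ones keep it positive when [b] or
   [n] is 0. *)
move=> b0 cov; exists (n.+1%:R * (b + 1)); first by rewrite mulr_gt0 ?ltr_wpDl.
move=> x Vx c; have [y Ly xy] := cov x.
have [_ [/(_ _ Ly) + _]] := Qnp x; rewrite Vx subr0 => le1.
have := le_trans (normsq_ge _ c) (le_trans le1 (normsq_le _ _ b0 xy)).
rewrite -real_normK ?num_real// => le2.
rewrite -(@ler_pXn2r _ 2) ?nnegrE// ?mulr_ge0 ?addr_ge0//.
apply: le_trans le2 _; rewrite exprMn ler_pM ?exprn_ge0//.
  by rewrite -natrX ler_nat -mulnn mulSn (leq_trans (leqnSn n))// leq_addr.
by rewrite lerXn2r ?nnegrE ?addr_ge0// lerDl.
Qed.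

Lemma lam_int_combination m (a : 'I_m -> int) (x : 'I_m -> 'cV[R]_n) :
  (forall l, Lam (x l)) -> Lam (\sum_l (a l)%:~R *: x l).
Proof.
move=> Lx; have LamN y : Lam y -> Lam (- y).
  by move=> Ly; rewrite -sub0r; apply: LamB => //; exact: lam0.
have LamD y z : Lam y -> Lam z -> Lam (y + z).
  by move=> Ly Lz; rewrite -[z]opprK; apply/LamB/LamN.
have LamMn y k : Lam y -> Lam (y *+ k).
  by move=> Ly; elim: k => [|k IH]; [exact: lam0 | rewrite mulrS; exact: LamD].
apply: (big_ind Lam lam0 LamD) => l _; rewrite scaler_int.
by case: (a l) => k; [|apply: LamN]; exact: LamMn.
Qed.

End Quantizer.

(** * Construction A lattices and their labelling by words over ['F_gamma] *)

Section ConstructionA.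
Context {R : realType} {gamma n K : nat}.
Variables (G : 'M['F_gamma]_(n, K)) (B : 'M[R]_n) (i : nat -> nat).
Hypothesis gamma_pr : prime gamma.
Hypothesis G_rank : \rank G = K.
Hypothesis B_unit : B \in unitmx.

(** Integer vectors index the lattice [gamma^-1 B Z^n], which contains the whole chain; membership
    in each [Lat k] becomes a condition on the residue [cls y] alone. *)
Definition fine_pt (y : 'cV[int]_n) : 'cV[R]_n :=
  B *m (gamma%:R^-1 *: map_mx intr y).
Definition cls (y : 'cV[int]_n) : 'cV['F_gamma]_n := map_mx intr y.
Definition repr (v : 'cV['F_gamma]_n) : 'cV[int]_n :=
  map_mx (fun a => Posz (nat_of_ord a)) v.

Let gamma0 : gamma%:R != 0 :> R.
Proof. by rewrite pnatr_eq0 -lt0n prime_gt0. Qed.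

Lemma fine_ptB y y' : fine_pt y - fine_pt y' = fine_pt (y - y').
Proof. by rewrite /fine_pt -mulmxBr -scalerBr map_mxB. Qed.

Lemma fine_pt_sum m (a : 'I_m -> int) (y : 'I_m -> 'cV[int]_n) :
  \sum_l (a l)%:~R *: fine_pt (y l) = fine_pt (\sum_l a l *: y l).
Proof.
rewrite /fine_pt; under eq_bigr do rewrite scalemxAr.
rewrite -mulmx_sumr; congr (B *m _); apply/matrixP => r c.
rewrite !mxE !summxE rmorph_sum mulr_sumr /=; apply: eq_bigr => l _.
by rewrite !mxE intrM mulrCA.
Qed.

Lemma fine_pt_inj : injective fine_pt.
Proof.
move=> y y' /(congr1 (mulmx (invmx B))); rewrite !mulKmx//.
move=> /(congr1 (fun x => gamma%:R *: x)); rewrite !scalerA mulfV// !scale1r.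
by move=> /matrixP e; apply/matrixP => r c; have := e r c; rewrite !mxE => /intr_inj.
Qed.

Lemma clsB y y' : cls (y - y') = cls y - cls y'.
Proof. exact: map_mxB. Qed.

Lemma reprK v : cls (repr v) = v.
Proof. by apply/matrixP => r c; rewrite !mxE -pmulrn natr_Zp. Qed.

Lemma cls_eq0 y : cls y = 0 -> exists z : 'cV[int]_n, y = gamma%:Z *: z.
Proof.
move=> y0; exists (map_mx (fun a => (a %/ gamma%:Z)%Z) y); apply/matrixP => r c.
rewrite !mxE mulrC divzK// (dvdz_pcharf (pchar_Fp gamma_pr)).
by move/matrixP: y0 => /(_ r c); rewrite !mxE => ->.
Qed.

(** Factoring out [gamma^-1] turns [gamma^-1 g(v) + z] into [gamma^-1 (g(v) + gamma z)], and the
    vectors [g(v) + gamma z] are exactly the integer vectors of residue [v]. *)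
Lemma Lat_fine_pt k x : Lat G B i k x <->
  exists2 w, supp 0 (i k) w & exists2 y, cls y = G *m w & x = fine_pt y.
Proof.
split=> [[w [sw [z ->]]]|[w /suppP sw [y yw ->]]].
  exists w.
    by apply/suppP => j; rewrite -leqNgt => /sw.
  exists (repr (G *m w) + gamma%:Z *: z).
    apply/matrixP => r c; rewrite !mxE /= rmorphD/= rmorphM/= -!pmulrn natr_Zp.
    by rewrite [X in X * _]pchar_Fp_0// mul0r addr0.
  rewrite /fine_pt; congr (B *m _); apply/matrixP => r c; rewrite !mxE.
  by rewrite rmorphD/= rmorphM/= mulrDr mulKf.
exists w; split=> [j ij|].
  by apply: sw; rewrite -leqNgt.
have [z yz] : exists z, y - repr (G *m w) = gamma%:Z *: z.
  by apply: cls_eq0; rewrite clsB reprK yw subrr.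
exists z; rewrite /fine_pt; congr (B *m _); apply/matrixP => r c.
rewrite -[y](subrK (repr (G *m w))) yz !mxE.
by rewrite rmorphD/= rmorphM/= mulrDr mulKf// addrC.
Qed.

Lemma mulmxG_inj p : injective (fun u : 'M['F_gamma]_(K, p) => G *m u).
Proof.
move=> u v /(congr1 trmx); rewrite !trmx_mul => /row_free_inj e.
apply: trmx_inj; apply: e; by rewrite /row_free mxrank_tr G_rank.
Qed.

Lemma LatB k x y : Lat G B i k x -> Lat G B i k y -> Lat G B i k (x - y).
Proof.
move=> /Lat_fine_pt[w sw [a aw ->]] /Lat_fine_pt[w' sw' [a' aw' ->]].
apply/Lat_fine_pt; exists (w - w'); first exact: suppB.
by exists (a - a'); rewrite ?fine_ptB// clsB aw aw' mulmxBr.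
Qed.

Definition lat_pt (w : 'cV['F_gamma]_K) : 'cV[R]_n := fine_pt (repr (G *m w)).

Lemma Lat_lat_ptB k w w' :
  Lat G B i k (lat_pt w - lat_pt w') <-> supp 0 (i k) (w - w').
Proof.
rewrite /lat_pt fine_ptB; split=> [/Lat_fine_pt[u su [y yu /fine_pt_inj e]]|sw].
  suff -> : w - w' = u by [].
  by apply: mulmxG_inj; rewrite -yu -e clsB !reprK mulmxBr.
apply/Lat_fine_pt; exists (w - w') => //; eexists; last by [].
by rewrite clsB !reprK mulmxBr.
Qed.

Lemma lat_pt0 : lat_pt 0 = 0.
Proof.
rewrite /lat_pt mulmx0 /fine_pt (_ : map_mx intr _ = 0) ?scaler0 ?mulmx0//.
by apply/matrixP => r c; rewrite !mxE.
Qed.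

Lemma Lat_lat_pt k w : Lat G B i k (lat_pt w) <-> supp 0 (i k) w.
Proof. by have := Lat_lat_ptB k w 0; rewrite lat_pt0 !subr0. Qed.

(** [lat_pt] is not additive, but the error has residue 0, hence lies in [B Z^n] and in every
    lattice of the chain. Integer combinations of lattice points thus become combinations of words
    over ['F_gamma]. *)
Lemma Lat_lat_pt_sum k m (a : 'I_m -> int) (w : 'I_m -> 'cV['F_gamma]_K) :
  Lat G B i k (\sum_l (a l)%:~R *: lat_pt (w l) - lat_pt (\sum_l (a l)%:~R *: w l)).
Proof.
rewrite fine_pt_sum fine_ptB; apply/Lat_fine_pt; exists 0.
  by apply/suppP => j _; rewrite mxE.
eexists; last by [].
rewrite clsB reprK mulmx0; apply/eqP; rewrite subr_eq0; apply/eqP.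
rewrite /cls raddf_sum mulmx_sumr; apply: eq_bigr => l _.
by rewrite /= map_mxZ -scalemxAr /= -{2}(reprK (G *m w l)).
Qed.

Lemma Lat_subP a b : (i a <= K)%N ->
  Lat G B i a `<=` Lat G B i b <-> (i a <= i b)%N.
Proof.
move=> aK; split=> [sub|ab x]; last first.
  case/Lat_fine_pt => w /suppP sw yw; apply/Lat_fine_pt; exists w => //.
  apply/suppP => j; rewrite -leqNgt => /(leq_trans ab) aj.
  by apply: sw; rewrite -leqNgt.
rewrite leqNgt; apply/negP => ba; have bK := leq_trans ba aK.
(* The unit word at position [i b] labels a point of [Lat a] outside [Lat b]; the bound [i a <= K]
   makes this position exist. *)
pose w : 'cV['F_gamma]_K := delta_mx (Ordinal bK) 0.
have : Lat G B i b (lat_pt w).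
  apply/sub/Lat_lat_pt/suppP => j; rewrite -leqNgt => aj; rewrite mxE.
  rewrite andbT (_ : _ == _ = false)//.
  by apply: contraTF aj => /eqP ->; rewrite -ltnNge.
move=> /Lat_lat_pt/suppP/(_ (Ordinal bK)); rewrite -leqNgt leqnn => /(_ isT)/eqP.
by rewrite mxE !eqxx oner_eq0.
Qed.

Section Encoding.
Variable Q : set 'cV[R]_n -> 'cV[R]_n -> 'cV[R]_n.
Variables a b : nat.
Hypothesis Qnp : nearest_point_map Q (Lat G B i a).
Hypothesis ab : (i a <= i b)%N.
Hypothesis aK : (i a <= K)%N.

(* Locked: comparing two encodings by conversion would unfold matrix products. *)
Definition enc : 'cV['F_gamma]_K -> 'cV[R]_n :=
  locked (fun w => modL Q (Lat G B i a) (lat_pt w)).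

Lemma encE w : enc w = modL Q (Lat G B i a) (lat_pt w).
Proof. by rewrite /enc -lock. Qed.

Lemma enc_eqP w w' : enc w = enc w' <-> supp 0 (i a) (w - w').
Proof.
rewrite !encE; split=> [/(modL_eqP _ _ Qnp (@LatB a))/Lat_lat_ptB//|/Lat_lat_ptB e].
exact/(modL_eqP _ _ Qnp (@LatB a)).
Qed.

(** The difference of the two words is supported both below [i a] and from [i a] on. *)
Lemma enc_inj w w' : supp (i a) K w -> supp (i a) K w' -> enc w = enc w' -> w = w'.
Proof.
move=> /suppP sw /suppP sw' /enc_eqP /suppP sww'.
apply/colP => j; have [aj|ja] := leqP (i a) j; last first.
  by rewrite sw ?sw'// negb_and -ltnNge ja.
by apply/eqP; rewrite -subr_eq0 -(sww' j) ?mxE// -leqNgt.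
Qed.

(** Erasing the coordinates of a word below [i a] moves its point by an element of [Lat a], and each
    coset of [Lat a] meets the Voronoi cell in exactly its common remainder. *)
Lemma Lat_Vor_enc : Lat G B i b `&` Vor Q (Lat G B i a) =
  enc @` [set w | supp (i a) (i b) w].
Proof.
have subab : Lat G B i a `<=` Lat G B i b by apply/Lat_subP.
apply/seteqP; split=> [x [/Lat_fine_pt[w /suppP sw [y yw ->]] Vx]|_ [w /suppP sw <-]].
  pose w' : 'cV['F_gamma]_K := \col_j (if (i a <= j)%N then w j 0 else 0).
  exists w'.
    apply/suppP => j; rewrite mxE; have [aj|//] := leqP (i a) j.
    by rewrite /= => bj; apply: sw.
  rewrite encE -[RHS](modL_id Q (Lat G B i a))//; apply/esym.
  apply/(modL_eqP _ _ Qnp (@LatB a)); rewrite /lat_pt fine_ptB.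
  apply/Lat_fine_pt; exists (w - w'); last first.
    by eexists; last by []; rewrite clsB reprK yw mulmxBr.
  by apply/suppP => j; rewrite -leqNgt !mxE => ->; rewrite subrr.
rewrite encE; split; last exact: Vor_modL (@LatB a) _.
rewrite /modL; apply: LatB; last by apply: subab; have [] := Qnp (lat_pt w).
by apply/Lat_lat_pt/suppP => j nj; apply: sw; rewrite negb_and nj orbT.
Qed.

End Encoding.

End ConstructionA.

(** * Separation and covering bounds for the lattices *)

Section LatticeGeometry.
Context {R : realType} {gamma n K : nat}.
Variables (G : 'M['F_gamma]_(n, K)) (B : 'M[R]_n) (i : nat -> nat).
Hypothesis gamma_pr : prime gamma.
Hypothesis B_unit : B \in unitmx.

Lemma mulmx_bound (M : 'M[R]_n) : exists2 C : R, 0 < C &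
  forall (x : 'cV[R]_n) (e : R), (forall c, `|x c 0| <= e) ->
  forall r, `|(M *m x) r 0| <= C * e.
Proof.
(* The summand 1 keeps the constant positive when [M] is 0. *)
exists (1 + \sum_r \sum_c `|M r c|).
  by rewrite ltr_wpDr// sumr_ge0// => r _; rewrite sumr_ge0.
move=> x e xe r; have e0 : 0 <= e by exact: le_trans (xe r).
rewrite mxE; apply: le_trans (ler_norm_sum _ _ _) _.
apply: (@le_trans _ _ (\sum_c `|M r c| * e)).
  by apply: ler_sum => c _; rewrite normrM ler_wpM2l.
rewrite -mulr_suml ler_wpM2r//; apply: ler_wpDl => //.
rewrite [leRHS](bigD1 r)//= lerDl sumr_ge0// => r' _; exact: sumr_ge0.
Qed.

(** Applying [gamma%:R *: invmx B] to a nonzero lattice point gives a nonzero integer vector, and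
    [invmx B] enlarges coordinates at most by a factor [C]. *)
Lemma Lat_separated k : exists2 eta : R, 0 < eta &
  forall y, Lat G B i k y -> y != 0 -> exists c, eta <= `|y c 0|.
Proof.
have g0 : 0 < gamma%:R :> R by rewrite ltr0n prime_gt0.
have [C C0 HC] := mulmx_bound (invmx B).
(* The factor 2 bounds each entry of [z] by one half in absolute value, which an integer other than
   0 cannot satisfy. *)
exists (C * (2 * gamma%:R))^-1; first by rewrite invr_gt0 !mulr_gt0.
move=> y /(Lat_fine_pt _ _ _ gamma_pr)[w _ [z _ yz]] y0.
have [//|nex] := pselect (exists c, (C * (2 * gamma%:R))^-1 <= `|y c 0|).
have lt c : `|y c 0| <= (C * (2 * gamma%:R))^-1.
  by rewrite leNgt; apply/negP => /ltW H; apply: nex; exists c.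
suff z0 : z = 0.
  by move: y0; rewrite yz z0 /fine_pt map_mx0 scaler0 mulmx0 eqxx.
apply/colP => r; rewrite mxE; apply/eqP; apply: contraT => zr0.
have := HC _ _ lt r; rewrite yz /fine_pt mulKmx// !mxE.
rewrite invfM mulrA mulfV ?gt_eqF// mul1r invfM normrM gtr0_norm ?invr_gt0//.
rewrite [leRHS]mulrC ler_pM2l ?invr_gt0// -intr_norm => le2.
have : (1 : R) <= 2^-1.
  by apply: le_trans le2; rewrite ler1z -gtz0_ge1 normr_gt0.
by rewrite invf_ge1// lern1.
Qed.

(** Rounding down the coordinates of [x] in the basis [B] gives a point of [B Z^n], which lies in
    [Lat k] through the zero word; the rounding error is at most 1 per coordinate. *)
Lemma Lat_covering k : exists2 b : R, 0 <= b &
  forall x, exists2 y, Lat G B i k y & forall c, `|(x - y) c 0| <= b.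
Proof.
have g0 : gamma%:R != 0 :> R by rewrite pnatr_eq0 -lt0n prime_gt0.
have [C C0 HC] := mulmx_bound B; exists C; first exact: ltW.
move=> x; have [u ->] : exists u, x = B *m u.
  by exists (invmx B *m x); rewrite mulKVmx.
pose z := map_mx Num.floor u.
exists (fine_pt (gamma := gamma) B (gamma%:Z *: z) : 'cV[R]_n).
  apply/(Lat_fine_pt _ _ _ gamma_pr); exists 0.
    by apply/suppP => j _; rewrite mxE.
  exists (gamma%:Z *: z) => //; rewrite mulmx0 /cls map_mxZ.
  by rewrite /= -pmulrn pchar_Fp_0// scale0r.
have -> : fine_pt (gamma := gamma) B (gamma%:Z *: z) = B *m map_mx intr z.
  rewrite /fine_pt; congr (B *m _); apply/matrixP => r c.
  by rewrite !mxE rmorphM/= mulKf.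
move=> c; rewrite -mulmxBr -[leRHS]mulr1.
apply: HC => r; rewrite !mxE ger0_norm ?subr_ge0 ?floor_le//.
by have /andP[_] := floor_itv (u r 0); rewrite lerBlDl rmorphD /= => /ltW.
Qed.

End LatticeGeometry.

Lemma log2_expn {R : realType} m e : (0 < m)%N ->
  log2 (m ^ e)%:R = e%:R * log2 m%:R :> R.
Proof. by move=> m0; rewrite /log2 natrX lnXn ?ltr0n// mulrA mulr_natl. Qed.

Lemma all_nth_ord {R : realType} n (P : R -> bool) (s : seq R) : size s = n ->
  all P s <-> forall r : 'I_n, P (nth 0 s r).
Proof.
move=> sn; split=> [/(all_nthP 0) H r|H]; first by apply: H; rewrite sn.
by apply/(all_nthP 0) => j; rewrite sn => jn; exact: (H (Ordinal jn)).
Qed.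

(** General in [V] so that it serves both real families of codewords and word matrices over
    ['F_gamma]. *)
Lemma restrict_col_eqP {V : nmodType} n L (S : {set 'I_L}) (x y : 'M[V]_(n, L)) :
  \matrix_(r, m) (if m \in S then x r m else 0) =
  \matrix_(r, m) (if m \in S then y r m else 0)
  <-> forall m, m \in S -> col m x = col m y.
Proof.
split=> [/matrixP e m mS|e]; first by apply/colP => r; have := e r m; rewrite !mxE mS.
apply/matrixP => r m; rewrite !mxE; case: ifP => // /e/colP/(_ r).
by rewrite !mxE.
Qed.

Lemma projS_eqP {R : realType} n L (S : {set 'I_L}) (x y : 'M[R]_(n, L)) :
  projS S x = projS S y <-> forall m, m \in S -> col m x = col m y.
Proof. exact: restrict_col_eqP. Qed.

(** * The common shaping lattice and the volume of the dither region *)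

Section CommonShaping.
Variables (R : realType) (gamma n K L : nat).
Variables (G : 'M['F_gamma]_(n, K)) (B : 'M[R]_n) (i pi : nat -> nat).
Variables (beta : 'I_L -> R) (A : 'M[int]_L).
Variable Q : set 'cV[R]_n -> 'cV[R]_n -> 'cV[R]_n.
Hypothesis gamma_pr : prime gamma.
Hypothesis L_gt0 : (0 < L)%N.
Hypothesis G_rank : \rank G = K.
Hypothesis B_unit : B \in unitmx.
Hypothesis i_mono : forall k, (k.+1 < 2 * L)%N -> (i k <= i k.+1)%N.
Hypothesis i_le_K : (i (2 * L).-1 <= K)%N.
Hypothesis Qnp : forall k, (k < 2 * L)%N -> nearest_point_map Q (Lat G B i k).
Hypothesis pi_lt : forall k, (k < 2 * L)%N -> (pi k < 2 * L)%N.
Hypothesis pi_inj : forall k k', (k < 2 * L)%N -> (k' < 2 * L)%N ->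
  pi k = pi k' -> k = k'.
Hypothesis LamSC : forall l : 'I_L, LamS G B i pi l `<=` LamC G B i pi l.
Hypothesis beta_gt0 : forall l, 0 < beta l.
Hypothesis LamS_const : forall l l' : 'I_L, LamS G B i pi l = LamS G B i pi l'.

Let Lam0 := Lat G B i 0.
Let Lat_sub := Lat_subP G B i gamma_pr G_rank B_unit.

Lemma i_homo a b : (a <= b)%N -> (b < 2 * L)%N -> (i a <= i b)%N.
Proof.
elim: b => [|b IH]; first by rewrite leqn0 => /eqP ->.
rewrite leq_eqVlt ltnS => /orP[/eqP ->//|ab bL].
exact: leq_trans (IH ab (ltnW bL)) (i_mono _ bL).
Qed.

Lemma i_leK k : (k < 2 * L)%N -> (i k <= K)%N.
Proof.
move=> kL; apply: leq_trans i_le_K; apply: i_homo.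
  by rewrite -ltnS prednK// (leq_ltn_trans _ kL).
by rewrite prednK ?leqnn// (leq_ltn_trans _ kL).
Qed.

Let L2_gt0 : (0 < 2 * L)%N. Proof. by rewrite muln_gt0. Qed.

Lemma sidx_lt (l : 'I_L) : (2 * l < 2 * L)%N.
Proof. by rewrite ltn_pmul2l. Qed.

Lemma cidx_bound (l : 'I_L) : ((2 * l).+1 < 2 * L)%N.
Proof. by rewrite !mul2n -doubleS leq_double. Qed.

Lemma cidx_lt (l : 'I_L) : (cidx pi l < 2 * L)%N.
Proof. exact/pi_lt/cidx_bound. Qed.

(* Index 0 is either a shaping index or a coding index; in the second case the common
   shaping lattice lies between Lat 0 and a coding lattice equal to Lat 0. *)
Lemma LamS_eq (l : 'I_L) : LamS G B i pi l = Lam0.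
Proof.
have sub0 k : (k < 2 * L)%N -> Lam0 `<=` Lat G B i k.
  by move=> kL; apply/Lat_sub; [exact: i_leK | exact: i_homo].
have [k kL k0] : exists2 k, (k < 2 * L)%N & pi k = 0.
  pose f (k : 'I_(2 * L)) := Ordinal (pi_lt _ (ltn_ord k)).
  have f_inj : injective f.
    by move=> k k' /(congr1 val) /= /pi_inj e; apply: val_inj; exact: e.
  exists (invF f_inj (Ordinal L2_gt0)) => //.
  by have /(congr1 val) := f_invF f_inj (Ordinal L2_gt0).
(* Positions [2 * l] and [(2 * l).+1] of [pi] belong to source [l], so [k./2] is the source to which
   index 0 is assigned. *)
have k2 : (k./2 < L)%N.
  rewrite -ltn_double -!mul2n (leq_ltn_trans _ kL)//.
  by rewrite mul2n -{2}(odd_double_half k) leq_addl.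
rewrite (LamS_const l (Ordinal k2)).
have [kodd|keven] := boolP (odd k); last first.
  rewrite /LamS /sidx /= (_ : 2 * k./2 = k)%N ?k0//.
  by rewrite mul2n -{2}(odd_double_half k) (negbTE keven).
apply/seteqP; split; last by apply: sub0; exact/pi_lt/sidx_lt.
have := LamSC (Ordinal k2); rewrite /LamC /cidx /= (_ : (2 * k./2).+1 = k)%N ?k0//.
by rewrite mul2n -{2}(odd_double_half k) kodd.
Qed.

Lemma i0_cidx (l : 'I_L) : (i 0 <= i (cidx pi l))%N.
Proof. by apply: i_homo => //; exact: cidx_lt. Qed.

(** [fine] sends infinity to 0 and division by 0 returns 0, so the normalisation in [Prv] is
    faithful only once these volumes are known to be finite and positive. The inner and outer cubes
    of the Voronoi cell, rescaled by [beta l], show this. *)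
Lemma leb_DsetV l : exists2 r : R, 0 < r &
  leb_mx (DsetV G B i pi beta Q l) = r%:E.
Proof.
have [eta eta0 sep] := Lat_separated G B i gamma_pr B_unit 0.
have [b b0 cov] := Lat_covering G B i gamma_pr B_unit 0.
have LB := @LatB _ _ _ _ G B i gamma_pr 0.
have [a a0 inner] := Vor_inner Q Lam0 (Qnp 0 L2_gt0) LB eta eta0 sep.
have [c c0 outer] := Vor_outer Q Lam0 (Qnp 0 L2_gt0) b b0 cov.
rewrite /leb_mx muln1.
apply: (@iter_int_bounded _ _ _ (a / beta l) (c / beta l)); rewrite ?divr_gt0//.
  move=> s sn /(all_nth_ord n _ _ sn) sa; rewrite /DsetV /= LamS_eq.
  apply: inner => r; rewrite !mxE normrM gtr0_norm// mul0n add0n.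
  by rewrite mulrC -ler_pdivlMr// sa.
move=> s sn; rewrite /DsetV /= LamS_eq => /outer sc.
apply/(all_nth_ord n _ _ sn) => r; have := sc r; rewrite !mxE mul0n add0n.
by rewrite normrM gtr0_norm// mulrC -ler_pdivlMr.
Qed.

(** [mat_of_seq] fills a matrix column by column, so the dither of source [l] occupies the [l]-th
    block of [n] consecutive coordinates and the volume factors over the sources. *)
Lemma leb_Dset :
  leb_mx (Dset G B i pi beta Q) =
  (\prod_l fine (leb_mx (DsetV G B i pi beta Q l)))%:E.
Proof.
rewrite [LHS]/leb_mx mulnC.
have E l : leb_mx (DsetV G B i pi beta Q l) =
    iter_int n (ind_seq (fun s => DsetV G B i pi beta Q l (mat_of_seq n 1 s))).
  by rewrite /leb_mx muln1.
rewrite -(iter_int_prod n _ (fun l s => DsetV G B i pi beta Q l (mat_of_seq n 1 s))).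
- apply: eq_iter_int => s sn; congr (if _ then _ else _)%:E.
  have colE l : col l (mat_of_seq n L s) = mat_of_seq n 1 (take n (drop (l * n) s)).
    by apply/colP => r; rewrite !mxE mul0n add0n nth_take// nth_drop.
  by apply: asbool_equiv_eq; split=> H l; have := H l; rewrite /DsetV /= colE.
- by move=> l; have [r r0 ->] := leb_DsetV l.
- by move=> l; rewrite -E; have [r r0 ->] := leb_DsetV l.
Qed.

(** * Message tuples as matrices over ['F_gamma] *)

Definition active (j : nat) : {set 'I_L} :=
  [set l | (i 0 <= j < i (cidx pi l))%N]%SET.

(** Constrained row by row, the shape counted by [card_imset_mulmx]; [msgsP] gives the view by
    columns, one per source. *)
Definition msgs : {set 'M['F_gamma]_(K, L)} :=
  [set w : 'M['F_gamma]_(K, L) |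
    [forall j : 'I_K, forall l, (l \notin active j) ==> (w j l == 0)]]%SET.

Definition encm : 'M['F_gamma]_(K, L) -> 'M[R]_(n, L) :=
  locked (fun w => \matrix_(r, l) enc G B i Q 0 (col l w) r 0).

Lemma col_encm l w : col l (encm w) = enc G B i Q 0 (col l w).
Proof. by apply/colP => r; rewrite /encm -lock !mxE. Qed.

Lemma msgsP (w : 'M['F_gamma]_(K, L)) :
  reflect (forall l, supp (i 0) (i (cidx pi l)) (col l w)) (w \in msgs).
Proof.
rewrite inE; apply: (iffP forallP) => H.
  move=> l; apply/suppP => j nj; rewrite mxE.
  by move/forallP: (H j) => /(_ l); rewrite inE nj => /eqP.
move=> j; apply/forallP => l; rewrite inE; apply/implyP => nj.
by have /suppP/(_ _ nj) := H l; rewrite mxE => ->.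
Qed.

Lemma msgsB w w' : w \in msgs -> w' \in msgs -> w - w' \in msgs.
Proof.
move=> /msgsP sw /msgsP sw'; apply/msgsP => l.
by rewrite (_ : col l _ = col l w - col l w') ?suppB//; apply/colP => j; rewrite !mxE.
Qed.

Lemma msgs0 : 0 \in msgs.
Proof. by apply/msgsP => l; apply/suppP => j _; rewrite !mxE. Qed.

(** Right multiplication mixes entries within a row only, so the rows below [i 0] remain zero;
    [encm] is therefore injective on such products. *)
Lemma msgs_mul_supp w (M : 'M['F_gamma]_L) l : w \in msgs ->
  supp (i 0) K (col l (w *m M)).
Proof.
move=> /msgsP sw; apply/suppP => j; rewrite ltn_ord andbT => nj; rewrite !mxE.
rewrite big1// => c _; have /suppP/(_ j) := sw c; rewrite negb_and nj => /(_ isT).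
by rewrite mxE => ->; rewrite mul0r.
Qed.

Lemma encm_inj (w w' : 'M['F_gamma]_(K, L)) :
  (forall l, supp (i 0) K (col l w)) -> (forall l, supp (i 0) K (col l w')) ->
  encm w = encm w' -> w = w'.
Proof.
move=> sw sw' e; apply/matrixP => j l.
suff /colP/(_ j) : col l w = col l w' by rewrite !mxE.
apply: (enc_inj _ _ _ gamma_pr G_rank B_unit _ _ (Qnp 0 L2_gt0)).
- exact: sw.
- exact: sw'.
- by rewrite -!col_encm e.
Qed.

Lemma msgs_inj : {in msgs &, injective encm}.
Proof.
move=> w w' /msgsP sw /msgsP sw'; apply: encm_inj => l.
  exact: supp_widen (i_leK _ (cidx_lt l)) (sw l).
exact: supp_widen (i_leK _ (cidx_lt l)) (sw' l).
Qed.

Lemma Cb_enc (l : 'I_L) : Cb G B i pi Q l =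
  enc G B i Q 0 @` [set w | supp (i 0) (i (cidx pi l)) w].
Proof.
rewrite /Cb LamS_eq; apply: Lat_Vor_enc => //; first exact: Qnp.
  exact: i0_cidx.
exact: i_leK.
Qed.

Lemma card_Lat_Vor k k' : (k < 2 * L)%N -> (k' < 2 * L)%N -> (k <= k')%N ->
  card_set (Lat G B i k' `&` Vor Q (Lat G B i k)) =
  #|[set w : 'cV['F_gamma]_K | supp (i k) (i k') w]%SET|.
Proof.
move=> kL k'L kk'; have iK := i_leK _ k'L.
rewrite (Lat_Vor_enc _ _ _ gamma_pr G_rank B_unit _ _ _
  (Qnp _ kL) (i_homo _ _ kk' k'L) (i_leK _ kL)).
have enc_set_inj : {in [set w : 'cV['F_gamma]_K | supp (i k) (i k') w]%SET &,
    injective (enc G B i Q k)}.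
  move=> w w'; rewrite !inE => sw sw'.
  apply: (enc_inj _ _ _ gamma_pr G_rank B_unit _ _ (Qnp _ kL)).
    exact: supp_widen iK sw.
  exact: supp_widen iK sw'.
rewrite -(card_set_image enc_set_inj).
by congr (card_set (_ @` _)); apply/seteqP; split=> w /=; rewrite inE.
Qed.

Lemma Tset_encm : Tset G B i pi Q = encm @` [set w | w \in msgs].
Proof.
apply/seteqP; split=> [t Tt|_ [w /msgsP sw <-] l]; last first.
  by rewrite Cb_enc col_encm; exists (col l w); [exact: sw|by []].
have /choice[f fP] : forall l, exists w, supp (i 0) (i (cidx pi l)) w /\
    enc G B i Q 0 w = col l t.
  by move=> l; have := Tt l; rewrite Cb_enc => -[w ? ?]; exists w.
have colf l : col l (\matrix_(j, l) f l j 0) = f l by apply/colP => j; rewrite !mxE.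
exists (\matrix_(j, l) f l j 0).
  by apply/msgsP => l; rewrite colf; have [] := fP l.
apply/matrixP => r l; have [_ /colP/(_ r)] := fP l.
by rewrite -colf -col_encm !mxE.
Qed.

Lemma prod_card_Cb :
  \prod_(l < L) (card_set (Cb G B i pi Q l))%:R^-1 = #|msgs|%:R^-1 :> R.
Proof.
suff -> : #|msgs| = (\prod_(l < L) card_set (Cb G B i pi Q l))%N.
  by rewrite natr_prod prodfV.
rewrite (_ : msgs = [set w : 'M['F_gamma]_(K, L) |
    [forall l, supp (i 0) (i (cidx pi l)) (col l w)]]%SET); last first.
  by apply/setP => w; rewrite [RHS]inE; apply/msgsP/forallP.
rewrite (card_forall_col _ _ _ (fun l => [pred v | supp (i 0) (i (cidx pi l)) v])).
by apply: eq_bigr => l _; rewrite /Cb LamS_eq card_Lat_Vor ?cidx_lt// cardsE.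
Qed.

(** With every shaping lattice equal to [Lam0], all quantizer outputs, those of the dithered terms
    included, are points of [Lam0]; their integer combinations disappear in the final reduction, and
    the dither with them. *)
Lemma vmap_encm w d : w \in msgs ->
  vmap G B i pi beta A Q (encm w) d = encm (w *m (Agam gamma A)^T).
Proof.
move=> wM; apply/matrixP => r m; rewrite [LHS]mxE.
have -> : encm (w *m (Agam gamma A)^T) r m = col m (encm (w *m (Agam gamma A)^T)) r 0.
  by rewrite mxE.
rewrite col_encm encE; congr (fun_of_matrix _ r 0).
have LB := @LatB _ _ _ _ G B i gamma_pr 0.
have Q0 := Qnp 0 L2_gt0.
apply/(modL_eqP _ _ Q0 LB).
(* Each summand is the unreduced point of its word minus two points of [Lam0]. *)
have tE l : col l (encm w) - Q (LamS G B i pi l) (col l (encm w) - beta l *: col l d) =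
    lat_pt G B (col l w) - (Q Lam0 (lat_pt G B (col l w)) +
      Q Lam0 (col l (encm w) - beta l *: col l d)).
  by rewrite LamS_eq {1}col_encm encE /modL opprD addrA.
under eq_bigr do rewrite tE scalerBr.
rewrite sumrB addrAC; apply: (LB).
  rewrite (_ : col m _ = \sum_l (A m l)%:~R *: col l w); first exact: Lat_lat_pt_sum.
  apply/colP => j; rewrite !mxE summxE; apply: eq_bigr => l _.
  by rewrite !mxE mulrC.
apply: (lam_int_combination Q _ Q0 LB) => l; rewrite -[X in _ + X]opprK.
have QL x : Lam0 (Q Lam0 x) by have [] := Q0 x.
apply: (LB); first exact: QL.
by rewrite -sub0r; apply: (LB); [exact: (lam0 Q _ Q0 LB)|exact: QL].
Qed.

(** * The law of the computed codewords *)

Definition mask (S : {set 'I_L}) : 'M['F_gamma]_L :=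
  \matrix_(l, m) (if m \in S then Agam gamma A m l else 0).

(** The number of values taken by the subfamily of codewords indexed by [S]. [mask] zeroes the other
    columns instead of deleting them, in parallel with [projS]. *)
Definition npat (S : {set 'I_L}) : nat := #|[set w *m mask S | w in msgs]%SET|.

Lemma maskT : mask finset.setT = (Agam gamma A)^T.
Proof. by apply/matrixP => l m; rewrite !mxE inE. Qed.

Lemma mul_mask w S : w *m mask S =
  \matrix_(j, m) (if m \in S then (w *m (Agam gamma A)^T) j m else 0)
  :> 'M['F_gamma]_(K, L).
Proof.
apply/matrixP => j m; rewrite [RHS]mxE !mxE; case: ifPn => mS.
  by apply: eq_bigr => l _; rewrite !mxE mS.
by rewrite big1// => l _; rewrite !mxE (negbTE mS) mulr0.
Qed.

Lemma npat_gt0 S : (0 < npat S)%N.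
Proof. by apply/card_gt0P; exists (0 *m mask S); apply: imset_f; exact: msgs0. Qed.

(** For a fixed message the event does not vary with the dither, so the dither integral is either
    the full volume or 0, and the probability is a proportion of messages. *)
Lemma Prv_count E : Prv G B i pi beta A Q E =
  #|[set w in msgs | `[< E (encm (w *m (Agam gamma A)^T)) >]]%SET|%:R / #|msgs|%:R.
Proof.
have D0 : 0 < \prod_l fine (leb_mx (DsetV G B i pi beta Q l)).
  by apply: prodr_gt0 => l _; have [r r0 ->] := leb_DsetV l.
rewrite /Prv Tset_encm (sum_fset_set_image msgs_inj) [RHS]mulrC.
rewrite mulr_natr -sumr_const big_mkcond [RHS]big_mkcond; apply: eq_bigr => w _.
rewrite inE; case: ifPn => //= wM; rewrite prod_card_Cb.
case: asboolP => Ew.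
  rewrite (_ : [set d | _] = Dset G B i pi beta Q) ?leb_Dset/= ?divff ?mulr1 ?gt_eqF//.
  by apply/seteqP; split=> [d []|d Dd] //=; rewrite vmap_encm.
rewrite (_ : [set d | _] = set0); last first.
  by apply/seteqP; split=> d //= -[_]; rewrite vmap_encm.
rewrite /leb_mx (_ : iter_int _ _ = 0%E) ?mul0r ?mulr0//.
rewrite -[RHS](iter_int0 (n * L)); apply: eq_iter_int => s _.
by rewrite ifF//; apply: asboolF.
Qed.

(** Such an event is a single fiber of the linear map [mask S] on the group [msgs], and by
    [card_fiber] its share is one over the size of the image. *)
Lemma Prv_fiber S E w0 : w0 \in msgs ->
  (forall w, w \in msgs ->
    E (encm (w *m (Agam gamma A)^T)) <-> w *m mask S = w0 *m mask S) ->
  Prv G B i pi beta A Q E = (npat S)%:R^-1.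
Proof.
move=> w0M EP; rewrite Prv_count.
have := card_fiber _ _ (mulmxr (mask S)) msgs w0 msgsB w0M => /= cardM.
rewrite (_ : [set w in msgs | _]%SET =
    [set w in msgs | w *m mask S == w0 *m mask S]%SET).
  rewrite -cardM natrM invfM mulrA mulfV ?mul1r//.
  rewrite pnatr_eq0 -lt0n; apply/card_gt0P; exists w0.
  by rewrite inE w0M eqxx.
apply/setP => w; rewrite !inE; apply: andb_id2l => wM.
have {}wM : w \in msgs by rewrite inE.
by apply/asboolP/eqP => H; exact/(EP w wM).
Qed.

Lemma encm_projS S w w0 : w \in msgs -> w0 \in msgs ->
  projS S (encm (w *m (Agam gamma A)^T)) = projS S (encm (w0 *m (Agam gamma A)^T))
  <-> w *m mask S = w0 *m mask S.
Proof.
move=> wM w0M; rewrite !mul_mask.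
have := fun l => msgs_mul_supp _ (Agam gamma A)^T l wM.
have := fun l => msgs_mul_supp _ (Agam gamma A)^T l w0M.
move: (w *m _) (w0 *m _) => u u0 su0 su.
split=> [/projS_eqP e|/restrict_col_eqP e].
  apply/restrict_col_eqP => m mS.
  apply: (enc_inj _ _ _ gamma_pr G_rank B_unit _ _ (Qnp 0 L2_gt0)).
  - exact: su.
  - exact: su0.
  - by rewrite -(col_encm m u) -(col_encm m u0) e.
by apply/projS_eqP => m mS; rewrite !col_encm e.
Qed.

Lemma pv_encm w : w \in msgs ->
  pv G B i pi beta A Q (encm (w *m (Agam gamma A)^T)) = (npat finset.setT)%:R^-1.
Proof.
move=> wM; apply: (Prv_fiber _ _ _ wM) => w' w'M /=; rewrite maskT; split=> [|->//].
by apply: encm_inj => l; exact: msgs_mul_supp.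
Qed.

Lemma pv_support : [set x | 0 < pv G B i pi beta A Q x] =
  encm @` [set u | u \in [set w *m mask finset.setT | w in msgs]%SET].
Proof.
apply/seteqP; split=> [x /=|_ [_ /imsetP[w wM ->] <-] /=]; last first.
  by rewrite maskT pv_encm// invr_gt0 ltr0n npat_gt0.
rewrite /pv Prv_count => D0.
have /card_gt0P[w] : (0 < #|[set w in msgs |
    `[< [set x]%classic (encm (w *m (Agam gamma A)^T)) >]]%SET|)%N.
  by rewrite lt0n; apply: contraTneq D0 => ->; rewrite mul0r ltxx.
rewrite inE => /andP[wM /asboolP/= <-].
by exists (w *m (Agam gamma A)^T) => //; apply/imsetP; exists w; rewrite ?maskT.
Qed.

(** The full family and its restriction to the complement of [S] are both uniform on their ranges,
    so all summands are equal and the conditional entropy is a difference of logarithms of range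
    sizes. *)
Lemma Hcond_npat S : Hcond G B i pi beta A Q S =
  n%:R^-1 * (log2 (npat finset.setT)%:R - log2 (npat (~: S)%SET)%:R).
Proof.
rewrite /Hcond pv_support sum_fset_set_image; last first.
  move=> _ _ /imsetP[w wM ->] /imsetP[w' w'M ->].
  by apply: encm_inj => l; exact: msgs_mul_supp.
have pos T : ((npat T)%:R : R) \is Num.pos by rewrite posrE ltr0n npat_gt0.
congr (_ * _); set N := npat finset.setT.
rewrite (eq_bigr (fun=> N%:R^-1 *
    (log2 (npat (~: S)%SET)%:R - log2 N%:R))); last first.
  move=> _ /imsetP[w wM ->]; rewrite [in w *m _]maskT pv_encm//.
  rewrite (Prv_fiber (~: S)%SET _ w)//; last first.
    by move=> w' w'M; exact: encm_projS.
  by congr (_ * _); rewrite invrK mulrC /log2 ln_div// mulrBl.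
rewrite sumr_const -/(npat _) -/N -mulrnAl -mulr_natl mulfV ?mul1r ?opprB//.
by rewrite pnatr_eq0 -lt0n npat_gt0.
Qed.

(** * From range sizes to sums of ranks along the chain *)

Lemma rvE k : (k.+1 < 2 * L)%N ->
  rv G B i Q k = n%:R^-1 * ((i k.+1 - i k)%:R * log2 gamma%:R).
Proof.
move=> kL; rewrite /rv card_Lat_Vor//; last exact: ltnW.
rewrite card_supp ?card_Fp ?i_leK ?i_mono//.
by rewrite log2_expn// prime_gt0.
Qed.

(** Each coding dimension is one of the breakpoints of the chain, so none falls strictly inside
    [[i k, i k.+1)]: a source that uses one column of this block uses them all. *)
Lemma Lk_active k j : (k.+1 < 2 * L)%N -> (i k <= j < i k.+1)%N ->
  Lk L G B i pi k = active j.
Proof.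
move=> kL /andP[kj jk]; apply/setP => l; rewrite !inE LamS_eq.
have cL := cidx_lt l; have kL' := ltnW kL.
have i0j : (i 0 <= j)%N by apply: leq_trans kj; exact: i_homo.
rewrite i0j /=; apply/asboolP/idP => [[_ [_ /Lat_sub]]|jc].
  by move=> /(_ (i_leK _ kL)); exact: leq_trans.
split; [|split]; apply/Lat_sub; rewrite ?i_leK ?i_homo//.
rewrite ltnNge; apply: contraTN jc => ck; rewrite -leqNgt.
exact: leq_trans (i_homo _ _ ck kL') kj.
Qed.

Lemma subrank0 S : subrank gamma A S finset.set0 = 0%N.
Proof.
rewrite /subrank rank_mask (_ : \matrix_(r, c) _ = 0) ?mxrank0//.
by apply/matrixP => r c; rewrite !mxE inE andbF.
Qed.

(** [card_imset_mulmx] gives one rank per row [j]. Rows outside the range of the chain have no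
    active source and rank 0; the others are grouped into blocks by [sum_chain]. *)
Lemma npatE S : npat S =
  (gamma ^ \sum_(k < (2 * L).-1)
     subrank gamma A S (Lk L G B i pi k) * (i k.+1 - i k))%N.
Proof.
have pL : ((2 * L).-1 < 2 * L)%N by rewrite prednK.
have -> : (\sum_(k < (2 * L).-1) subrank gamma A S (Lk L G B i pi k) * (i k.+1 - i k) =
    \sum_(i 0 <= j < i (2 * L).-1) subrank gamma A S (active j))%N.
  rewrite (sum_chain _ _ (fun k => subrank gamma A S (Lk L G B i pi k))).
  - by apply: eq_bigr => k _; rewrite -mulr_natr natn.
  - by move=> k kL; apply: i_mono; rewrite -ltn_predRL.
  - by move=> k j kL /Lk_active ->//; rewrite -ltn_predRL.
have out j : ~~ (i 0 <= j < i (2 * L).-1)%N -> subrank gamma A S (active j) = 0%N.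
  move=> nj; rewrite (_ : active j = finset.set0) ?subrank0//.
  apply/setP => l; rewrite !inE; apply: contraNF nj => /andP[-> /leq_trans]; apply.
  by apply: i_homo => //; rewrite -ltnS prednK// cidx_lt.
rewrite /npat /msgs card_imset_mulmx card_Fp// -expn_sum; congr (_ ^ _)%N.
transitivity (\sum_(j < K) subrank gamma A S (active j))%N.
  (* [mask S] holds the transpose of [Agam], hence the passage to the transposed rank. *)
  apply: eq_bigr => j _; rewrite /subrank rank_mask -mxrank_tr; congr (\rank _).
  by apply/matrixP => r c; rewrite !mxE; case: (c \in _); rewrite ?andbT ?andbF.
rewrite (big_nat_widen _ _ _ _ _ i_le_K) big_geq_mkord [RHS]big_mkcond /=.
by apply: eq_bigr => j _; case: ifPn => //; rewrite andbC => /out.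
Qed.

Lemma fcpr_eq_Hcond S : fcpr G B i pi A Q S = Hcond G B i pi beta A Q S.
Proof.
rewrite Hcond_npat !npatE !log2_expn ?prime_gt0// !natr_sum -mulrBl -sumrB.
rewrite mulr_suml mulr_sumr; apply: eq_bigr => k _.
rewrite rvE; last by rewrite -ltn_predRL.
by rewrite !natrM -mulrBl mulrCA !mulrA.
Qed.

End CommonShaping.

Theorem theorem8 (R : realType) (gamma n K L : nat)
  (G : 'M['F_gamma]_(n, K)) (B : 'M[R]_n) (i pi : nat -> nat)
  (beta : 'I_L -> R) (A : 'M[int]_L)
  (Q : set 'cV[R]_n -> 'cV[R]_n -> 'cV[R]_n) :
  prime gamma -> (0 < L)%N -> (0 < n)%N -> (0 < K)%N ->
  \rank G = K ->
  B \in unitmx ->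
  (* 0 <= i_1 <= ... <= i_{2L} <= K *)
  (forall k, (k.+1 < 2 * L)%N -> (i k <= i k.+1)%N) ->
  (i (2 * L).-1 <= K)%N ->
  (* Q is the nearest-point quantizer of each lattice of the chain *)
  (forall k, (k < 2 * L)%N -> nearest_point_map Q (Lat G B i k)) ->
  (* pi is a permutation of the 2L lattice indices *)
  (forall k, (k < 2 * L)%N -> (pi k < 2 * L)%N) ->
  (forall k k', (k < 2 * L)%N -> (k' < 2 * L)%N -> pi k = pi k' -> k = k') ->
  (forall l : 'I_L, LamS G B i pi l `<=` LamC G B i pi l) ->
  (forall l, 0 < beta l) ->
  Agam gamma A \in unitmx ->
  (* common shaping lattice *)
  (forall l l' : 'I_L, LamS G B i pi l = LamS G B i pi l') ->
  Rcpr G B i pi A Q = RSW G B i pi beta A Q.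
Proof.
move=> gamma_pr L0 n0 _ G_rank B_unit i_mono iK Qnp pi_lt pi_inj LSC beta0 _ LS.
by apply/seteqP; split=> Rt H S; have := H S;
  rewrite (fcpr_eq_Hcond _ _ _ _ _ _ _ _ _ beta).
Qed.
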